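(* Let $n\ge 4$ and $k\ge 5$ be integers. Then $ex_{\mathcal{P}}(n,\{C_3,C_k\})=2n-4$, and the complete bipartite graph $K_{2,n-2}$ is an extremal graph, i.e. $K_{2,n-2}$ is a $\{C_3,C_k\}$-free planar graph on $n$ vertices with exactly $2n-4$ edges.
   Context: All graphs are simple, finite and undirected. $C_k$ denotes the cycle of length $k$. For a family $\mathcal{H}$ of graphs, a graph is $\mathcal{H}$-free if it contains no subgraph (not necessarily induced) isomorphic to a member of $\mathcal{H}$. The planar Turán number $ex_{\mathcal{P}}(n,\mathcal{H})$ is the maximum number of edges in an $\mathcal{H}$-free planar graph on $n$ vertices. *)

(* Defs.v *)
From HB Require Import structures.
From mathcomp Require Import all_boot all_order all_algebra.
From mathcomp Require Import all_classical all_reals all_analysis.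

Set Implicit Arguments.
Unset Strict Implicit.
Unset Printing Implicit Defensive.

Import Order.TTheory GRing.Theory Num.Theory.
Import numFieldNormedType.Exports.

(* A simple graph with vertex set T is a set of 2-element subsets of T.
   Being a subtype of {set {set T}}, the graphs on T form a finType. *)
Record sgraph (T : finType) := SGraph {
  edges : {set {set T}};
  edges_card2 : [forall e in edges, #|e| == 2]
}.

HB.instance Definition _ (T : finType) := [isSub for @edges T].
HB.instance Definition _ (T : finType) := [Finite of sgraph T by <:].

Definition edges_of_rel (T : finType) (r : rel T) : {set {set T}} :=
  [set e : {set T} | (#|e| == 2) &&
     [exists u, exists v, r u v && (e == [set u; v])]]%SET.

Lemma edges_of_rel_card2 (T : finType) (r : rel T) :
  [forall e in edges_of_rel r, #|e| == 2].
Proof. by apply/forall_inP => e; rewrite inE => /andP[]. Qed.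

(* The symmetric closure of r, without loops. *)
Definition graph_of_rel (T : finType) (r : rel T) : sgraph T :=
  SGraph (edges_of_rel_card2 r).

Record graph := Graph { vertex : finType; sgraph_of :> sgraph vertex }.

(* ordS is the successor modulo k. This is the cycle of length k for k >= 3;
   for k <= 2 it degenerates to a graph with at most one edge. *)
Definition cycle_graph (k : nat) : graph :=
  Graph (graph_of_rel (fun i j : 'I_k => j == ordS i)).

Definition complete_bipartite (a b : nat) : graph :=
  Graph (graph_of_rel (fun u v : 'I_a + 'I_b =>
    if (u, v) is (inl _, inr _) then true else false)).

(* The image of H under f is a subgraph of G isomorphic to H. *)
Definition has_subgraph (H : graph) (T : finType) (G : sgraph T) : Prop :=
  exists f : vertex H -> T, injective f /\
    forall e : {set vertex H}, e \in edges H -> (f @: e)%SET \in edges G.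

Definition graph_family := graph -> Prop.

Definition family2 (H1 H2 : graph) : graph_family :=
  fun H => H = H1 \/ H = H2.

Definition family_free (F : graph_family) (T : finType) (G : sgraph T) : Prop :=
  forall H : graph, F H -> ~ has_subgraph H G.

Local Open Scope classical_set_scope.

Definition is_arc (R : realType) (A : set (R * R)) (a b : R * R) : Prop :=
  exists g : R -> R * R,
    [/\ {within `[0%R, 1%R], continuous g},
        {in `[0%R, 1%R] &, injective g},
        g 0%R = a, g 1%R = b
      & A = g @` `[0%R, 1%R]].

(* p places the vertices in the plane and A e is the closed arc representing
   the edge e. An arc contains no vertex besides its ends, and two distinct
   arcs meet only in the common ends of their edges. *)
Definition is_plane_drawing (R : realType) (T : finType) (G : sgraph T)
    (p : T -> R * R) (A : {set T} -> set (R * R)) : Prop :=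
  [/\ injective p,
      forall u v : T, [set u; v]%SET \in edges G ->
        is_arc (A [set u; v]%SET) (p u) (p v),
      forall (e : {set T}) (w : T), e \in edges G -> A e (p w) -> w \in e
    & forall (e e' : {set T}) (x : R * R),
        e \in edges G -> e' \in edges G -> e != e' -> A e x -> A e' x ->
        exists2 w : T, w \in (e :&: e')%SET & x = p w].

Definition planar (R : realType) (T : finType) (G : sgraph T) : Prop :=
  exists (p : T -> R * R) (A : {set T} -> set (R * R)),
    is_plane_drawing G p A.

Definition planar_turan (R : realType) (n : nat) (F : graph_family) : nat :=
  \max_(G : sgraph 'I_n | `[< planar R G /\ family_free F G >]) #|edges G|.

(* Main.v *)
Require Import Defs.
From mathcomp Require Import all_boot all_order all_algebra.
From mathcomp Require Import all_classical all_reals all_analysis.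
From mathcomp Require Import zify lra.

(** The upper bound 2n - 4 is Euler's formula together with the fact that every
    face of a triangle-free plane graph has length at least four.  The arcs of
    a drawing are merely continuous, so the faces are not taken in the plane
    itself; the proof avoids the Jordan curve theorem altogether.

    What is kept of planarity is a duality over the two-element field
    ([planar_dual]): every edge of the graph has a left and a right face in
    some finite set, and the cycles (edge sets meeting every vertex an even
    number of times) are exactly the coboundaries of sets of faces.  This alone
    yields the bound ([planar_dual_edge_bound]).  There are at least
    2 ^ (E - V + 1) cycles.  If f faces have a nonempty frontier there are at
    most 2 ^ (f - 1) coboundaries, because complementary sets of faces have the
    same one; so f >= E - V + 2.  Each frontier is a nonempty cycle, hence has at
    least four edges, and each edge lies on at most two frontiers, so
    4 f <= 2 E.

    The duality is obtained in two steps.  A square grid has it, by counting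
    the parity of crossings along vertical rays ([torus_cycle_cobd]), and it
    passes to minors ([minor_planar_dual]): contracting edges keeps the faces,
    and deleting edges merges them.  So it is enough to find the graph as a minor
    of a fine grid.  Cut every arc into three thirds.  Thirds that do not meet
    are at positive distance from each other, by compactness.  When the mesh is
    small compared with these distances, following the arcs by lattice walks
    gives walks of different edges that meet only within thirds adjacent to a
    common vertex ([curves_planar_dual]).  The branch set of a vertex consists
    of the nearby ends of the walks at it, together with the middle parts of
    the walks leaving it; the edge itself becomes the lattice step by which its
    walk first reaches the part near its target ([first_contact]).

    For the lower bound, K_(2,m) is drawn with straight segments from two poles
    to points of a line.  It has no cycle of length k unless k divides 2 or 4:
    along a cycle the sides alternate, so the vertices 2 and 4 steps after a pole
    are poles too, and two of these three coincide. *)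

Set Implicit Arguments.
Unset Strict Implicit.
Unset Printing Implicit Defensive.

Import Order.TTheory GRing.Theory Num.Theory.
Import numFieldNormedType.Exports.

(** * Cycles, cuts and the edge bound *)

Section Duality.

Variables (V E F : finType) (s t : E -> V) (l r : E -> F).

(** Sets of edges, vertices and faces are chains modulo 2, that is, boolean
    functions added by exclusive or.  An end that an edge has twice counts
    twice, so loops have zero boundary. *)
Definition bd (z : E -> bool) (v : V) : bool :=
  \big[addb/false]_e (z e && ((s e == v) (+) (t e == v))).

Definition cobd (w : F -> bool) (e : E) : bool := w (l e) (+) w (r e).

Lemma bd_add (z1 z2 : E -> bool) v :
  bd (fun e => z1 e (+) z2 e) v = bd z1 v (+) bd z2 v.
Proof. by rewrite /bd -big_split; apply: eq_bigr => e _; rewrite andb_addl. Qed.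

Lemma eq_bd (z1 z2 : E -> bool) : z1 =1 z2 -> bd z1 =1 bd z2.
Proof. by move=> eq_z v; apply: eq_bigr => e _; rewrite eq_z. Qed.

Lemma bd0 v : bd (fun=> false) v = false.
Proof. by rewrite /bd big1. Qed.

Lemma bd_sum (J : finType) (z : J -> E -> bool) v :
  bd (fun e => \big[addb/false]_j z j e) v = \big[addb/false]_j bd (z j) v.
Proof.
rewrite /bd exchange_big /=; apply: eq_bigr => e _.
by elim/big_rec2: _ => //= j y1 y2 _ <-; rewrite andb_addl.
Qed.

Lemma sum_bd (X : pred V) (z : E -> bool) :
  \big[addb/false]_(v | X v) bd z v =
  \big[addb/false]_e (z e && (X (s e) (+) X (t e))).
Proof.
rewrite /bd exchange_big /=; apply: eq_bigr => e _.
have pick x : \big[addb/false]_(v | X v) (x == v) = X x.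
  case Xx: (X x); last first.
    by apply: big1 => v Xv; apply/eqP => exv; rewrite exv Xv in Xx.
  rewrite (bigD1 x) //= eqxx big1 // => v /andP[_].
  by rewrite eq_sym => /negbTE.
rewrite -!pick -big_split /=.
by rewrite big_distrr.
Qed.

(** The form in which planarity is used, close to the criterion of MacLane.  Faces
    without edges, and edges with the same face on both sides, are allowed. *)
Definition planar_dual :=
  forall z : E -> bool, (forall v, bd z v = false) <-> exists w, z =1 cobd w.

(** The sum of a boundary over all vertices vanishes, so a boundary is known from
    its values off one vertex [v0]; and two edge sets with the same boundary
    differ by a cycle. *)
Lemma card_cycles (v0 : V) :
  2 ^ #|E| <= #|[set z : {ffun E -> bool} | [forall v, ~~ bd z v]]| * 2 ^ #|V|.-1.
Proof.
set K := [set z | _].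
pose B (z : {ffun E -> bool}) := [set v | bd z v] :\ v0.
have -> : 2 ^ #|E| = #|{ffun E -> bool}| by rewrite card_ffun card_bool.
have BV z : B z \in powerset ([set: V] :\ v0).
  by rewrite inE finset.setSD // finset.subsetT.
have -> : 2 ^ #|V|.-1 = #|powerset ([set: V] :\ v0)|.
  by rewrite card_powerset cardsDS ?finset.subsetT // cardsT cards1 subn1.
rewrite -[#|{: {ffun _}}|]sum1_card (partition_big B (mem (powerset ([set: V] :\ v0)))) //=.
rewrite mulnC -sum_nat_const leq_sum // => S _.
rewrite sum1_card.
have [z0 z0S|none] := pickP (fun z => B z == S); last first.
  by rewrite (eq_card (B := pred0)) ?card0 // => z; apply: none.
pose f (z : {ffun E -> bool}) := [ffun e => z e (+) z0 e].
have f_inj : injective f.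
  by move=> z1 z2 /ffunP eqf; apply/ffunP => e; move: (eqf e); rewrite !ffunE => /addIb.
rewrite -(fintype.card_image f_inj).
apply/subset_leq_card/fintype.subsetP => _ /fintype.imageP[z zS ->].
have bdf v : bd (f z) v = bd z v (+) bd z0 v.
  by rewrite -bd_add; apply: eq_bd => e; rewrite ffunE.
have neq0 v : v != v0 -> bd (f z) v = false.
  move=> vv0; have /finset.setP/(_ v) : B z = B z0.
    by rewrite (eqP z0S); apply/eqP.
  by rewrite bdf !inE vv0 /= => ->; rewrite addbb.
rewrite inE; apply/forallP => v; have [->|/neq0->//] := eqVneq v v0.
have := sum_bd predT (f z); rewrite [RHS]big1 => [|e _]; last by rewrite andbF.
by rewrite (bigD1 v0) //= big1 ?addbF => [->|].
Qed.

(** Faces with empty frontier may occur and must be left out of the count: only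
    those in [F'] have a frontier of at least four edges. *)
Lemma planar_dual_edge_bound :
  planar_dual ->
  (forall z : {set E}, z != finset.set0 -> (forall v, bd (mem z) v = false) -> 4 <= #|z|) ->
  3 <= #|V| -> #|E| + 4 <= 2 * #|V|.
Proof.
move=> dual girth V3.
have [v0 _|] := pickP V; last by move=> /eq_card0 V0; rewrite V0 in V3.
pose Z (f : F) := [set e | cobd (pred1 f) e].
pose F' := [set f | Z f != finset.set0].
have cobdE (w : F -> bool) e :
    cobd w e = \big[addb/false]_(f | f \in F') (w f && (e \in Z f)).
  have -> : cobd w e = \big[addb/false]_f (w f && (e \in Z f)).
    have pick x : w x = \big[addb/false]_f (w f && (x == f)).
      rewrite (bigD1 x) //= eqxx andbT big1 ?addbF // => f.
      by rewrite eq_sym => /negbTE->; rewrite andbF.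
    rewrite /cobd !pick -big_split /=; apply: eq_bigr => f _.
    by rewrite inE /cobd /= andb_addr.
  rewrite (bigID (mem F')) /= [X in _ (+) X]big1 ?addbF // => f.
  by rewrite inE negbK => /eqP->; rewrite inE andbF.
have Zge f : f \in F' -> 4 <= #|Z f|.
  rewrite inE => Zf; apply: girth => // v.
  by move: v; apply/dual; exists (pred1 f) => e; rewrite /= inE.
have sumZ : \sum_(f in F') #|Z f| <= 2 * #|E|.
  apply: (@leq_trans (\sum_f #|Z f|)).
    by rewrite [leqRHS](bigID (mem F')) /= leq_addr.
  under eq_bigr do rewrite -sum1_card.
  rewrite (exchange_big_dep predT) //= mulnC -sum_nat_const leq_sum // => e _.
  rewrite sum1_card; apply: (@leq_trans #|[set l e; r e]|); last first.
    by rewrite cards2; case: eqP.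
  apply/subset_leq_card/fintype.subsetP => f; rewrite unfold_in => feZ; move: (feZ : e \in Z f).
  by rewrite !inE /cobd /= ![_ == f]eq_sym; do 2!case: eqP.
have four : 4 * #|F'| <= 2 * #|E|.
  by apply: leq_trans sumZ; rewrite mulnC -sum_nat_const leq_sum.
have cyc := card_cycles v0; set K := [set z | _] in cyc.
have bound : #|K| <= 2 ^ #|F'|.-1.
  pose G (W : {set F}) := [ffun e => cobd (mem W) e].
  have [f0 f0F|none] := pickP (mem F'); last first.
    have -> : #|F'| = 0 by apply: eq_card0.
    rewrite expn0 -(cards1 ([ffun=> false] : {ffun E -> bool})).
    apply/subset_leq_card/fintype.subsetP => z; rewrite !inE => /forallP zK.
    have [|w zw] := (dual z).1; first by move=> v; apply/negbTE.
    apply/eqP/ffunP => e; rewrite ffunE zw cobdE big1 // => f fF.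
    by have := none f; rewrite /= fF.
  have -> : 2 ^ #|F'|.-1 = #|powerset (F' :\ f0)|.
    by rewrite card_powerset (cardsD1 f0 F') (f0F : f0 \in F').
  apply: leq_trans (leq_imset_card G _).
  apply/subset_leq_card/fintype.subsetP => z; rewrite !inE => /forallP zK.
  have [|w zw] := (dual z).1; first by move=> v; apply/negbTE.
  (* A set of faces may be replaced by its complement, to avoid [f0]. *)
  apply/imsetP; exists [set f in F' | w f != w f0].
    rewrite inE; apply/fintype.subsetP => f; rewrite !inE => /andP[-> wf].
    by rewrite andbT; apply: contraNneq wf => ->.
  apply/ffunP => e; rewrite ffunE zw.
  transitivity (cobd (fun f => w f != w f0) e).
    by rewrite /cobd; do 3!case: (w _).
  rewrite !cobdE; apply: eq_bigr => f fF /=.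
  by rewrite [f \in [set _ | _]]inE fF.
have : #|E| <= #|F'|.-1 + #|V|.-1.
  rewrite -(@leq_exp2l 2) // expnD.
  by apply: leq_trans cyc _; rewrite leq_mul2r bound orbT.
have [|F0] := posnP #|F'|; lia.
Qed.

End Duality.

(** * Duality passes to minors *)

Lemma bd_pred1 (V E : finType) (s t : E -> V) (a : E) v :
  bd s t (pred1 a) v = (s a == v) (+) (t a == v).
Proof.
rewrite /bd (bigD1 a) //= eqxx big1 ?addbF // => e.
by move=> /negbTE ->.
Qed.

(** The host graph has edges [D] and vertices [P].  The second hypothesis concerns
    only cycles made of edges satisfying [S]; this lets a grid wrapped on a
    torus play the role of a planar host. *)
Section Minor.

Variables (P D F : finType) (hs ht : D -> P) (hl hr : D -> F) (S : pred D).
Hypothesis cobd_cycle : forall w c, bd hs ht (cobd hl hr w) c = false.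
Hypothesis cycle_cobd : forall z : D -> bool, (forall d, z d -> S d) ->
  (forall c, bd hs ht z c = false) -> exists w, z =1 cobd hl hr w.

(** The existence of an [S]-walk inside [X], in the homological form in which it
    is used. *)
Definition joined (X : pred P) (x y : P) :=
  exists z : D -> bool, (forall d, z d -> [&& S d, X (hs d) & X (ht d)]) /\
    forall c, bd hs ht z c = (x == c) (+) (y == c).

Lemma joined_refl (X : pred P) x : joined X x x.
Proof. by exists (fun=> false); split=> // c; rewrite bd0 addbb. Qed.

Lemma joined_trans (X : pred P) x y z : joined X x y -> joined X y z -> joined X x z.
Proof.
move=> [z1 [X1 bd1]] [z2 [X2 bd2]]; exists (fun d => z1 d (+) z2 d); split.
  by move=> d; have := X1 d; have := X2 d; case: (z1 d) (z2 d) => [] [] //= A B _; auto.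
by move=> c; rewrite bd_add bd1 bd2 -addbA [(y == c) (+) _]addbA addbb.
Qed.

Lemma joined_sym (X : pred P) x y : joined X x y -> joined X y x.
Proof. by move=> [z [? bdz]]; exists z; split=> // c; rewrite addbC. Qed.

Lemma joined_edge (X : pred P) d : S d -> X (hs d) -> X (ht d) ->
  joined X (hs d) (ht d).
Proof.
move=> Sd Xs Xt; exists (pred1 d); split=> [_ /eqP->|c]; first exact/and3P.
exact: bd_pred1.
Qed.

(** The graph on [V] and [E] is a minor of the host: [X v] is the branch set of [v],
    and [h e] the host edge that represents [e]. *)
Variables (V E : finType) (s t : E -> V) (X : V -> pred P) (b : V -> P) (h : E -> D).
Hypothesis X_disj : forall u v c, X u c -> X v c -> u = v.
Hypothesis st_neq : forall e, s e != t e.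
Hypothesis h_inj : injective h.
Hypothesis hS : forall e, S (h e).
(** The ends of [h e] are [x], on the side of the source, and [y], on the side of the
    target; the exclusive ors leave the orientation of [h e] open. *)
Hypothesis h_ends : forall e, exists x y,
  [/\ forall c, (hs (h e) == c) (+) (ht (h e) == c) = (x == c) (+) (y == c),
      forall u, (X u (hs (h e)) (+) X u (ht (h e))) = (s e == u) (+) (t e == u),
      joined (X (s e)) (b (s e)) x & joined (X (t e)) (b (t e)) y].

(** Contracted edges are the inner ones; those not kept are deleted, so the faces
    on their two sides merge. *)
Let inner : pred D := fun d => [&& S d & [exists u, X u (hs d) && X u (ht d)]].
Let kept : pred D := fun d => inner d || (d \in codom h).
Let across : rel F := fun f g =>
  [exists d, ~~ kept d && (((f, g) == (hl d, hr d)) || ((g, f) == (hl d, hr d)))].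

Lemma h_not_inner e : ~~ inner (h e).
Proof.
apply/negP => /andP[_ /existsP[u /andP[us ut]]].
have [_ [_ [_ /(_ (s e)) + _ _]]] := h_ends e.
rewrite eqxx eq_sym (negbTE (st_neq e)).
have pick v : X v (hs (h e)) = (u == v).
  by apply/idP/eqP => [/(X_disj us)|<-].
have pick' v : X v (ht (h e)) = (u == v).
  by apply/idP/eqP => [/(X_disj ut)|<-].
by rewrite pick pick' addbb.
Qed.

(** An edge of the minor lifts to a path between base points: contracted edges
    of the branch set of its source, then [h e], then contracted edges at its
    target. *)
Lemma edge_chain e : exists Z : D -> bool,
  [/\ forall d, Z d -> kept d, forall e', Z (h e') = (e' == e) &
      forall c, bd hs ht Z c = (b (s e) == c) (+) (b (t e) == c)].
Proof.
have [x [y [hxy _ [z1 [X1 bd1]] [z2 [X2 bd2]]]]] := h_ends e.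
have I1 d : z1 d -> inner d.
  by move=> /X1/and3P[Sd Xs Xt]; apply/andP; split=> //; apply/existsP; exists (s e); apply/andP.
have I2 d : z2 d -> inner d.
  by move=> /X2/and3P[Sd Xs Xt]; apply/andP; split=> //; apply/existsP; exists (t e); apply/andP.
exists (fun d => (z1 d (+) z2 d) (+) (d == h e)); split.
- move=> d; rewrite /kept; case Z1: (z1 d); first by rewrite (I1 d Z1).
  case Z2: (z2 d); first by rewrite (I2 d Z2).
  by move=> /eqP ->; rewrite codom_f orbT.
- move=> e'; rewrite (inj_eq h_inj).
  have /negbTE-> : ~~ z1 (h e') by apply: contra (h_not_inner e'); apply: I1.
  by have /negbTE-> : ~~ z2 (h e') by apply: contra (h_not_inner e'); apply: I2.
- move=> c; rewrite !bd_add bd1 bd2 bd_pred1 hxy.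
  by do 4!case: (_ == c).
Qed.

Lemma across_sym : connect_sym across.
Proof.
by apply: sym_connect_sym => f g; apply: eq_existsb => d; rewrite orbC.
Qed.

Lemma root_across d : ~~ kept d -> fingraph.root across (hl d) = fingraph.root across (hr d).
Proof.
move=> nkd; apply/eqP; rewrite (root_connect across_sym); apply/connect1/existsP.
by exists d; rewrite nkd eqxx.
Qed.

(** A cycle of the minor lifts through [edge_chain] to a cycle of the host using
    kept edges only; the host face set that bounds it is constant across deleted
    edges, hence descends to merged faces.  Conversely a set of merged faces
    gives a cycle of the host, and adding its boundaries over a branch set leaves
    only the edges with one end there. *)
Lemma minor_planar_dual :
  planar_dual s t (fun e => fingraph.root across (hl (h e)))
                  (fun e => fingraph.root across (hr (h e))).
Proof.
move=> z; split=> [cyc|[w zw] u].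
  have [Z ZP] := fin_all_exists edge_chain.
  pose zH d := \big[addb/false]_e (z e && Z e d).
  have zH_kept d : zH d -> kept d.
    apply: contraLR => nkd; rewrite /zH big1 // => e _.
    have [/(_ d) kd _ _] := ZP e; case Zed: (Z e d); last by rewrite andbF.
    by rewrite kd in nkd.
  have [w zHw] : exists w, zH =1 cobd hl hr w.
    apply: cycle_cobd => [d /zH_kept /orP[/andP[]//|/codomP[e ->]]|c].
      exact: hS.
    rewrite bd_sum (eq_bigr (fun e =>
      \big[addb/false]_v ((b v == c) && (z e && ((s e == v) (+) (t e == v)))))); last first.
      move=> e _; transitivity (z e && ((b (s e) == c) (+) (b (t e) == c))).
        case: (z e); last exact: bd0.
        by have [_ _ <-] := ZP e.
      rewrite (bigD1 (s e)) //= (bigD1 (t e)) /=; last by rewrite eq_sym st_neq.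
      rewrite !eqxx [t e == s e]eq_sym (negbTE (st_neq e)).
      rewrite big1 ?addbF => [|v /andP[vs vt]].
        by case: (z e); do 2!case: (_ == c).
      by rewrite ![_ == v]eq_sym (negbTE vs) (negbTE vt) !andbF.
    rewrite exchange_big big1 //= => v _.
    by rewrite -big_distrr /= -/(bd s t z v) cyc andbF.
  have w_const f g : connect across f g -> w f = w g.
    move=> /connectP[p + ->]; elim: p f => //= f' p IH f /andP[/existsP[d /andP[nkd fg]] /IH <-].
    have : ~~ zH d by apply: contra nkd; apply: zH_kept.
    rewrite zHw /cobd.
    by case/orP: fg => /eqP[-> ->]; case: (w _) (w _) => [] [].
  exists w => e; rewrite /cobd.
  rewrite -(w_const _ _ (connect_root _ (hl (h e)))).
  rewrite -(w_const _ _ (connect_root _ (hr (h e)))).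
  rewrite -/(cobd hl hr w (h e)) -zHw /zH (bigD1 e) //= big1 ?addbF.
    by have [_ -> _] := ZP e; rewrite eqxx andbT.
  by move=> e' ne; have [_ -> _] := ZP e'; rewrite eq_sym (negbTE ne) andbF.
pose w' f := w (fingraph.root across f).
have := sum_bd hs ht (X u) (cobd hl hr w'); rewrite big1 => [|c _]; last exact: cobd_cycle.
rewrite (bigID (mem (codom h))) /= [X in _ (+) X]big1 ?addbF; last first.
  move=> d dNh; case kd: (kept d); last first.
    by rewrite /cobd /w' root_across ?addbb // kd.
  move: kd; rewrite /kept (negbTE dNh) orbF => /andP[_ /existsP[v /andP[vs vt]]].
  suff -> : X u (hs d) = X u (ht d) by case: (cobd _ _ _ _) (X u _) => [] [].
  by apply/idP/idP => [/(X_disj vs)|/(X_disj vt)] <-.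
rewrite -big_uniq /=; last by rewrite /codom map_inj_uniq ?enum_uniq.
rewrite big_image /= => ->; apply: eq_bigr => e _.
by have [_ [_ [_ -> _ _]]] := h_ends e; rewrite zw.
Qed.

End Minor.

(** * The square grid *)

(** Wrapping the grid on a torus gives every point four edges and removes all
    border cases.  The torus is cut open along a row and a column: cycles that
    avoid the seam bound a set of unit squares. *)
Section Torus.
Local Open Scope ring_scope.

Variable N : nat.
Notation C := 'I_N.+2.
Notation point := (C * C)%type.
Notation tedge := (bool * point)%type.

(** [(false, c)] is the edge going right from [c] and [(true, c)] the one going up;
    the face named [c] is the unit square with lower left corner [c]. *)
Definition tsrc (d : tedge) : point := d.2.
Definition ttgt (d : tedge) : point :=
  if d.1 then (d.2.1, d.2.2 + 1) else (d.2.1 + 1, d.2.2).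
Definition tleft (d : tedge) : point :=
  if d.1 then (d.2.1 - 1, d.2.2) else (d.2.1, d.2.2 - 1).
Definition tright (d : tedge) : point := d.2.
Definition off_seam : pred tedge :=
  fun d => if d.1 then d.2.2 != -1 else d.2.1 != -1.

Lemma big_eq1 (I : finType) (z : I -> bool) i0 :
  \big[addb/false]_i (z i && (i == i0)) = z i0.
Proof.
rewrite (bigD1 i0) //= eqxx andbT big1 ?addbF // => i /negbTE ->.
by rewrite andbF.
Qed.

Lemma torus_bd (z : tedge -> bool) (c : point) :
  bd tsrc ttgt z c = (z (false, c) (+) z (false, (c.1 - 1, c.2))) (+)
                     (z (true, c) (+) z (true, (c.1, c.2 - 1))).
Proof.
rewrite /bd.
transitivity (\big[addb/false]_(a : bool) \big[addb/false]_(p : point)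
   ((z (a, p) && (p == c)) (+) (z (a, p) && (ttgt (a, p) == c)))).
  by rewrite pair_bigA; apply: eq_bigr => -[a p] _; rewrite andb_addr.
rewrite big_bool /= addbC !big_split /=.
rewrite !(big_eq1 (fun p => z (_, p))); congr ((_ (+) _) (+) (_ (+) _)).
- rewrite -[RHS](big_eq1 (fun p => z (false, p))); apply: eq_bigr => -[i j] _.
  by case: c => i0 j0; rewrite /ttgt /= !xpair_eqE [i == _]eq_sym subr_eq [i0 == _]eq_sym.
- rewrite -[RHS](big_eq1 (fun p => z (true, p))); apply: eq_bigr => -[i j] _.
  by case: c => i0 j0; rewrite /ttgt /= !xpair_eqE [j == j0 - 1]eq_sym subr_eq [j0 == _]eq_sym.
Qed.

Lemma torus_cobd_cycle (w : point -> bool) c :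
  bd tsrc ttgt (cobd tleft tright w) c = false.
Proof.
rewrite torus_bd /cobd /tleft /tright /=; case: c => i j /=.
by do 4!case: (w _).
Qed.

(** [w f] is the parity of the number of edges of the cycle below the square [f].
    Moving the column one step to the right changes it by the vertical edge
    crossed, because the boundary of [z] vanishes along the column.  A full
    column has even parity: this holds at the seam and is the same for all
    columns. *)
Lemma torus_cycle_cobd (z : tedge -> bool) : (forall d, z d -> off_seam d) ->
  (forall c, bd tsrc ttgt z c = false) -> exists w, z =1 cobd tleft tright w.
Proof.
move=> zS cyc.
pose w (f : point) := \big[addb/false]_(k : C | (k <= f.2)%N) z (false, (f.1, k)).
have zseam1 j : z (false, (-1, j)) = false.
  by apply/negP => /zS; rewrite /off_seam /= eqxx.
have zseam2 i : z (true, (i, -1)) = false.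
  by apply/negP => /zS; rewrite /off_seam /= eqxx.
have val_pred (j : C) : j != 0 -> (j - 1 : C) = j.-1 :> nat.
  rewrite -(inj_eq val_inj) -lt0n /= => j_gt0.
  rewrite [(1 %% _)%N]modn_small // subn1 [(N.+1 %% _)%N]modn_small //=.
  have -> : (j + N.+1 = j.-1 + N.+2)%N by lia.
  by rewrite modnDr modn_small //; have := ltn_ord j; lia.
have wh (i j : C) : j != 0 -> w (i, j) = w (i, j - 1) (+) z (false, (i, j)).
  move=> j0; rewrite /w /= (bigD1 j) //= addbC; congr (_ (+) _).
  apply: eq_bigl => k.
  rewrite -[RHS]/(k <= (j - 1)%R)%N (val_pred j j0).
  by move: j0; rewrite -!(inj_eq val_inj) /=; lia.
have wh0 (i : C) : w (i, 0) = z (false, (i, 0)).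
  rewrite /w (bigD1 0) //= big1 ?addbF // => k; rewrite leqn0.
  by rewrite -(inj_eq val_inj) /= => /andP[->].
have wv (i j : C) : w (i, j) (+) w (i - 1, j) = z (true, (i, j)).
  case: j => m; elim: m => [|m IH] mN.
    have -> : Ordinal mN = 0 :> C by apply: val_inj.
    rewrite !wh0; have := cyc (i, 0); rewrite torus_bd /= sub0r zseam2.
    by do 3!case: (z _).
  have mN' : (m < N.+2)%N by apply: leq_trans mN.
  set j := Ordinal mN.
  have jE : j - 1 = Ordinal mN' by apply: val_inj; exact: val_pred.
  rewrite (wh i j) // (wh (i - 1) j) // addbACA jE IH.
  have := cyc (i, j); rewrite torus_bd /= jE.
  by do 4!case: (z _).
have wtop i : w (i, -1) = false.
  have step i' : w (i', -1) = w (i' - 1, -1).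
    by have := wv i' (-1); rewrite zseam2; do 2!case: (w _).
  case: i => m; elim: m => [|m IH] mN; rewrite step.
    have -> : Ordinal mN = 0 :> C by apply: val_inj.
    by rewrite sub0r /w big1.
  have mN' : (m < N.+2)%N by apply: leq_trans mN.
  by rewrite (_ : _ - 1 = Ordinal mN') //; apply: val_inj; exact: val_pred.
exists w => -[[] [i j]]; rewrite /cobd /tleft /tright /=.
  by rewrite addbC wv.
have [->|j0] := eqVneq j 0; last by rewrite (wh _ j) // addKb.
by rewrite sub0r wtop wh0.
Qed.

End Torus.

(** * Lattice drawings *)

Section Drawing.

Variables (P D F : finType) (hs ht : D -> P) (hl hr : D -> F) (S : pred D).
Hypothesis cobd_cycle : forall w c, bd hs ht (cobd hl hr w) c = false.
Hypothesis cycle_cobd : forall z : D -> bool, (forall d, z d -> S d) ->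
  (forall c, bd hs ht z c = false) -> exists w, z =1 cobd hl hr w.

Definition neighbours (p q : P) :=
  exists2 d, S d & (hs d = p /\ ht d = q) \/ (hs d = q /\ ht d = p).

Definition steps (g : nat -> P) (n : nat) :=
  forall k, k < n -> g k = g k.+1 \/ neighbours (g k) (g k.+1).

Lemma joined_walk (X : pred P) (g : nat -> P) n i j :
  steps g n -> i <= j <= n -> (forall k, i <= k <= j -> X (g k)) ->
  joined hs ht S X (g i) (g j).
Proof.
move=> gn; elim: j => [|j IH] ijn Xg.
  by have -> : i = 0; [lia | exact: joined_refl].
have [->|ij] := eqVneq i j.+1; first exact: joined_refl.
apply: joined_trans (IH _ _) _; first 1 [lia].
  by move=> k ikj; apply: Xg; lia.
have Xj : X (g j) by apply: Xg; lia.
have Xj1 : X (g j.+1) by apply: Xg; lia.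
have [|-> |[d Sd [[sd td]|[sd td]]]] := gn j; first lia.
- exact: joined_refl.
- by rewrite -sd -td; apply: joined_edge; rewrite ?sd ?td.
- by apply: joined_sym; rewrite -sd -td; apply: joined_edge; rewrite ?sd ?td.
Qed.

Variables (V E : finType) (s t : E -> V) (b : V -> P).
Variables (g : E -> nat -> P) (a1 a2 n : nat).
Hypothesis a12n : a1 <= a2 <= n.
Hypothesis st_neq : forall e, s e != t e.
Hypothesis simple : forall e e', [set s e; t e] = [set s e'; t e'] -> e = e'.
Hypothesis g_src : forall e, g e 0 = b (s e).
Hypothesis g_tgt : forall e, g e n = b (t e).
Hypothesis g_steps : forall e, steps (g e) n.
Hypothesis g_open : forall e k, a2 <= k <= n -> g e 0 != g e k.

(** Walks have [n] steps; the indices below [a1] form the part near the source, those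
    from [a2] on the part near the target. *)
Definition near_end e k v := (k < a1) && (s e == v) || (a2 <= k) && (t e == v).

Hypothesis g_meet : forall e e' k k', k <= n -> k' <= n -> e != e' ->
  g e k = g e' k' -> exists2 v, near_end e k v & near_end e' k' v.

Let final e c := [exists k : 'I_n.+1, (a2 <= k) && (g e k == c)].

(** The branch set of [v]: the last parts of the walks ending at [v], and the walks
    starting at [v] without the points that their own last parts visit, which
    would otherwise belong to two branch sets. *)
Let X v : pred P := fun c => [exists e, (t e == v) && final e c ||
  [&& s e == v, ~~ final e c & [exists k : 'I_n.+1, g e k == c]]].

Lemma finalP e c : reflect (exists2 k, a2 <= k <= n & g e k = c) (final e c).
Proof.
apply: (iffP existsP) => [[k /andP[ak /eqP gk]]|[k /andP[ak kn] gk]].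
  by exists k => //; rewrite ak -ltnS ltn_ord.
by exists (inord k); rewrite inordK ?ltnS // ak gk eqxx.
Qed.

Lemma X_disj u v c : X u c -> X v c -> u = v.
Proof.
have Xw w : X w c -> exists e k, [/\ k <= n, g e k = c &
    a2 <= k /\ t e = w \/ [/\ k < a2, s e = w & ~~ final e c]].
  move=> /existsP[e /orP[/andP[/eqP te /finalP[k /andP[ak kn] gk]]|]].
    by exists e, k; split=> //; left.
  case/and3P=> /eqP se nf /existsP[k /eqP gk]; exists e, k.
  split=> //; first by rewrite -ltnS.
  right; split=> //; rewrite ltnNge; apply: contra nf => ak.
  by apply/finalP; exists k => //; rewrite ak -ltnS ltn_ord.
move=> /Xw[e [k [kn gk uk]]] /Xw[e' [k' [kn' gk' vk]]].
have [ee'|ne] := eqVneq e e'.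
  subst e'; case: uk vk => [[ak <-]|[_ <- nf]] [[ak' <-]|[_ <- nf']] //.
    by case/finalP: nf'; exists k; rewrite ?ak.
  by case/finalP: nf; exists k'; rewrite ?ak'.
have [|w] := g_meet kn kn' ne; first by rewrite gk.
rewrite /near_end => /orP[] /andP[kw /eqP ew] /orP[] /andP[kw' /eqP ew'];
  case: uk vk => [[? ?]|[? ? _]] [[? ?]|[? ? _]]; first [congruence | lia].
Qed.

(** Cut the walk of [e] at its first point visited by its last part.  Before
    it the walk stays in the branch set of the source; the remaining walk may
    return there, but the last part links this point to the target. *)
Lemma first_contact e : exists d, S d /\ exists x y,
  [/\ forall c, (hs d == c) (+) (ht d == c) = (x == c) (+) (y == c),
      forall u, (X u (hs d) (+) X u (ht d)) = (s e == u) (+) (t e == u),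
      joined hs ht S (X (s e)) (b (s e)) x & joined hs ht S (X (t e)) (b (t e)) y].
Proof.
have ex_final : exists k, final e (g e k).
  by exists n; apply/finalP; exists n => //; lia.
case: (ex_minnP ex_final) => [[|m] fm min].
  by case/finalP: fm => k akn /eqP; rewrite eq_sym (negbTE (g_open e akn)).
have mn : m < n.
  by apply: min; apply/finalP; exists n => //; lia.
have Xs k : k <= m -> X (s e) (g e k).
  move=> km; apply/existsP; exists e; apply/orP; right; apply/and3P; split=> //.
    by apply/negP => /min; lia.
  by apply/existsP; exists (inord k); rewrite inordK //; lia.
have Xt k : a2 <= k <= n -> X (t e) (g e k).
  move=> akn; apply/existsP; exists e; rewrite eqxx /=.
  by apply/orP; left; apply/finalP; exists k.
case/finalP: fm => m' am' gm'.
have Xm u : X u (g e m) = (s e == u).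
  by apply/idP/eqP => [|<-]; [apply: X_disj; apply: Xs | apply: Xs].
have Xm1 u : X u (g e m.+1) = (t e == u).
  by rewrite -gm'; apply/idP/eqP => [|<-]; [apply: X_disj; apply: Xt | apply: Xt].
have js : joined hs ht S (X (s e)) (b (s e)) (g e m).
  by rewrite -g_src; apply: joined_walk (g_steps e) _ _ => [|k /andP[_ /Xs]]; lia.
have jt : joined hs ht S (X (t e)) (b (t e)) (g e m.+1).
  rewrite -g_tgt -gm'; apply/joined_sym/(joined_walk (g_steps e)) => [|k km']; first lia.
  by apply: Xt; lia.
have [eqm|[d Sd hd]] := g_steps e mn.
  by have := Xm (t e); rewrite eqm Xm1 eqxx (negbTE (st_neq e)).
exists d; split=> //; exists (g e m), (g e m.+1); split=> // c.
  by case: hd => -[-> ->] //; rewrite addbC.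
by case: hd => -[-> ->]; rewrite Xm Xm1 // addbC.
Qed.

Lemma drawing_planar_dual : exists l r : E -> F, planar_dual s t l r.
Proof.
have [h hP] := fin_all_exists first_contact.
have hS e : S (h e) by have [] := hP e.
have h_ends e := (hP e).2.
have h_inj : injective h.
  move=> e e' hee'; apply: simple; apply/finset.setP => u.
  have [_ [_ [_ /(_ u) he _ _]]] := h_ends e.
  have [_ [_ [_ /(_ u) he' _ _]]] := h_ends e'.
  move: he'; rewrite -hee' he !inE ![u == _]eq_sym.
  have one f : ~~ ((s f == u) && (t f == u)).
    by apply: contra (st_neq f) => /andP[/eqP-> /eqP->].
  by move: (one e) (one e'); do 4!case: (_ == u).
by do 2![eexists]; apply: (minor_planar_dual cobd_cycle cycle_cobd X_disj st_neq h_inj hS h_ends).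
Qed.

End Drawing.

(** * Walks on the torus from natural coordinates *)

Section TorusSteps.
Local Open Scope ring_scope.
Variable N : nat.

Definition torus_point (c : nat * nat) : 'I_N.+2 * 'I_N.+2 := (inord c.1, inord c.2).

Lemma torus_point_inj c c' : (c.1 <= N)%N -> (c.2 <= N)%N -> (c'.1 <= N)%N -> (c'.2 <= N)%N ->
  torus_point c = torus_point c' -> c = c'.
Proof.
case: c c' => i j [i' j'] /= iN jN iN' jN' [/(congr1 val) + /(congr1 val)].
by rewrite /= !inordK ?ltnS; [move=> -> -> | lia..].
Qed.

Lemma inordS i : (i < N)%N -> inord i + 1 = inord i.+1 :> 'I_N.+2.
Proof.
move=> iN; apply: val_inj; rewrite /= !inordK ?modn_small; lia.
Qed.

Lemma inord_off_seam i : (i < N.+1)%N -> (inord i != -1 :> 'I_N.+2).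
Proof.
move=> iN; rewrite -(inj_eq val_inj) /= inordK; last by lia.
by rewrite [(1 %% _)%N]modn_small // subn1 modn_small //=; lia.
Qed.

Lemma torus_vstep (i j j' : nat) : (j <= N)%N -> (j' <= N)%N -> (j <= j'.+1)%N -> (j' <= j.+1)%N ->
  torus_point (i, j) = torus_point (i, j') \/
  neighbours (@tsrc N) (@ttgt N) (@off_seam N) (torus_point (i, j)) (torus_point (i, j')).
Proof.
move=> jN jN' jj jj'; have [->|[ej|ej]] : j = j' \/ j' = j.+1 \/ j = j'.+1 by lia.
- by left.
- right; exists (true, torus_point (i, j)).
    by rewrite /off_seam /= inord_off_seam.
  by left; rewrite /tsrc /ttgt /torus_point /= inordS ?ej //; lia.
- right; exists (true, torus_point (i, j')).
    by rewrite /off_seam /= inord_off_seam.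
  by right; rewrite /tsrc /ttgt /torus_point /= inordS ?ej //; lia.
Qed.

Lemma torus_hstep (i i' j : nat) : (i <= N)%N -> (i' <= N)%N -> (i <= i'.+1)%N -> (i' <= i.+1)%N ->
  torus_point (i, j) = torus_point (i', j) \/
  neighbours (@tsrc N) (@ttgt N) (@off_seam N) (torus_point (i, j)) (torus_point (i', j)).
Proof.
move=> iN iN' ii ii'; have [->|[ei|ei]] : i = i' \/ i' = i.+1 \/ i = i'.+1 by lia.
- by left.
- right; exists (false, torus_point (i, j)).
    by rewrite /off_seam /= inord_off_seam.
  by left; rewrite /tsrc /ttgt /torus_point /= inordS ?ei //; lia.
- right; exists (false, torus_point (i', j)).
    by rewrite /off_seam /= inord_off_seam.
  by right; rewrite /tsrc /ttgt /torus_point /= inordS ?ei //; lia.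
Qed.

End TorusSteps.

(** * Compactness *)

Section Topology.
Local Open Scope ring_scope.
Local Open Scope classical_set_scope.
Variable R : realType.
Implicit Types (g : R -> R * R).

Lemma within_dist (A : set R) g x e : {within A, continuous g} -> A x -> 0 < e ->
  exists2 d, 0 < d & forall y, A y -> `|x - y| < d -> `|g x - g y| < e.
Proof.
move=> gA Ax e0.
have /subspace_continuousP/(_ x Ax)/cvgrPdist_lt/(_ e e0) := gA.
by rewrite near_withinE => /nbhs_ballP[d /= d0 dg]; exists d => // y Ay xy; apply: dg.
Qed.

Lemma uniform_steps g e : {within `[0, 1], continuous g} -> 0 < e ->
  \forall d \near 0^'+, forall x y, `[0, 1] x -> `[0, 1] y -> `|x - y| < d -> `|g x - g y| < e.
Proof.
move=> gA e0.
have /compact_near_coveringP/near_covering_withinP cover := @segment_compact R 0 1.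
pose close d x := forall y, `[0, 1] y -> `|x - y| < d -> `|g x - g y| < e.
suff : \forall d \near 0^'+, `[0, 1] `<=` close d.
  by apply: filterS => d cl x y x01; apply: cl.
apply: cover => x x01.
have e20 : 0 < e / 2 by lra.
have [d d0 near_x] := within_dist gA x01 e20.
have d20 : 0 < d / 2 by lra.
near=> x' d' => x'01 y y01 x'y.
have xx' : `|x - x'| < d / 2.
  by near: x'; exact: cvgr_dist_lt.
have d'd : d' < d / 2 by near: d'; exact: nbhs_right_lt.
have gx : `|g x - g x'| < e / 2 by apply: near_x => //; apply: lt_trans xx' _; lra.
have gy : `|g x - g y| < e / 2.
  apply: near_x => //; apply: le_lt_trans (ler_distD x' x y) _; rewrite [d]splitr ltrD //.
  exact: lt_trans d'd.
apply: le_lt_trans (ler_distD (g x) (g x') (g y)) _; rewrite [e]splitr ltrD //.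
by rewrite distrC.
Unshelve. all: by end_near. Qed.

(** The differences x - y form a compact set that misses 0. *)
Lemma compact_dist_gt0 (A B : set (R * R)) : compact A -> compact B -> A `&` B = set0 ->
  \forall d \near 0^'+, forall x y, A x -> B y -> d <= `|x - y|.
Proof.
move=> cA cB AB.
pose f (p : (R * R) * (R * R)) := p.1 - p.2.
have fc : continuous f.
  move=> p; apply: continuousB; [exact: cvg_fst | exact: cvg_snd].
have cf : compact (f @` (A `*` B)).
  apply: continuous_compact; last exact: compact_setX.
  exact: continuous_subspaceT.
have /closed_openC : closed (f @` (A `*` B)).
  by apply: compact_closed cf; exact: norm_hausdorff.
have notin0 : (~` (f @` (A `*` B))) 0.
  move=> [[x y] [/= Ax By] /eqP]; rewrite subr_eq0 => /eqP/= xy; rewrite -xy in By.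
  by have : (A `&` B) x by []; rewrite AB.
rewrite openE => /(_ 0 notin0)/nbhs_normP [d /= d0 ballS].
near=> d' => x y Ax By; rewrite leNgt; apply/negP => xy.
apply: (ballS (x - y)); last by exists (x, y).
rewrite /ball_ /= sub0r normrN; apply: lt_trans xy _.
by near: d'; exact: nbhs_right_lt.
Unshelve. all: by end_near. Qed.

End Topology.

(** * From curves to lattice walks *)

Section Curves.
Local Open Scope ring_scope.
Local Open Scope classical_set_scope.
Variable R : realType.

Lemma truncn_close (h x y : R) : 0 < h -> 0 <= x -> 0 <= y -> `|x - y| < h ->
  (Num.truncn (x / h) <= (Num.truncn (y / h)).+1)%N.
Proof.
move=> h0 x0 y0 xy.
have xh : 0 <= x / h by rewrite divr_ge0 // ltW.
have yh : 0 <= y / h by rewrite divr_ge0 // ltW.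
have /andP[tx _] := truncn_itv xh; have /andP[_ ty] := truncn_itv yh.
rewrite -ltnS -(ltr_nat R); apply: le_lt_trans tx _.
rewrite -[_.+2]addn1 natrD; apply: lt_le_trans (_ : y / h + 1 <= _); last by rewrite lerD2r ltW.
by rewrite -ltrBlDl -mulrBl ltr_pdivrMr // mul1r (le_lt_trans (ler_norm _)).
Qed.

Lemma truncn_eq_dist (h x y : R) : 0 < h -> 0 <= x -> 0 <= y ->
  Num.truncn (x / h) = Num.truncn (y / h) -> `|x - y| < h.
Proof.
move=> h0 x0 y0 xy.
have xh : 0 <= x / h by rewrite divr_ge0 // ltW.
have yh : 0 <= y / h by rewrite divr_ge0 // ltW.
have := truncn_itv xh; have := truncn_itv yh; rewrite xy => Hy Hx.
have : `|x / h - y / h| < 1 by rewrite ltr_norml; move: Hx Hy; rewrite -natr1; lra.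
by rewrite -mulrBl normrM [`|h^-1|]gtr0_norm ?invr_gt0 // ltr_pdivrMr // mul1r.
Qed.

Lemma dist3 (h x x' y y' : R) : `|x - y| < h -> `|x' - y'| < h -> `|y - y'| < h ->
  `|x - x'| < h * 3.
Proof.
rewrite !ltr_norml => /andP[? ?] /andP[? ?] /andP[? ?].
by apply/andP; split; lra.
Qed.

(** With [m] samples per third of a curve and two lattice steps per sample, step [k]
    belongs to the sample [k./2]. *)
Lemma third_index m k : (k <= 2 * (3 * m))%N -> exists i : 'I_3,
  [/\ (i * m <= k./2 <= i.+1 * m)%N, i = 0 :> nat -> (k < 2 * m)%N &
      i = 2 :> nat -> (4 * m <= k)%N].
Proof.
move=> km; have [k2|k2] := ltnP k (2 * m).
  by exists (@Ordinal 3 0 isT); split=> //=; lia.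
have [k4|k4] := ltnP k (4 * m).
  by exists (@Ordinal 3 1 isT); split=> //=; lia.
by exists (@Ordinal 3 2 isT); split=> //=; lia.
Qed.

Definition third (i : 'I_3) : set R := `[i%:R / 3, i.+1%:R / 3].

Lemma third_ratio m j (i : 'I_3) : (0 < m)%N -> (i * m <= j <= i.+1 * m)%N ->
  third i (j%:R / (3 * m)%:R).
Proof.
move=> m0 /andP[ij ji]; have m3 : 0 < (3 * m)%:R :> R by rewrite ltr0n muln_gt0.
have cancel3 (x : R) : x / 3 * (3 * m)%:R = x * m%:R.
  by rewrite natrM mulrA divfK.
rewrite /third /= in_itv /= ler_pdivlMr // ler_pdivrMr // !cancel3.
by rewrite -!natrM !ler_nat ij ji.
Qed.

Lemma third0 (i : 'I_3) : third i 0 -> i = 0 :> nat.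
Proof.
rewrite /third /= in_itv /= => /andP[i0 _]; move: i0.
by rewrite pmulr_lle0 ?invr_gt0 // lern0 => /eqP.
Qed.

Lemma third1 (i : 'I_3) : third i 1 -> i = 2 :> nat.
Proof.
rewrite /third /= in_itv /= => /andP[_ i1]; move: i1.
by rewrite ler_pdivlMr // mul1r ler_nat; have := ltn_ord i; lia.
Qed.

Lemma third_segment i x : third i x -> `[0, 1] x.
Proof.
rewrite /third /= !in_itv /= => /andP[x1 x2]; apply/andP; split.
  by apply: le_trans x1; rewrite divr_ge0.
by apply: le_trans x2 _; rewrite ler_pdivrMr // mul1r ler_nat.
Qed.

(** Either the two pieces meet, and there is nothing to prove, or they are
    compact and disjoint. *)
Lemma separated_thirds (g g' : R -> R * R) (i i' : 'I_3) :
  {within `[0, 1], continuous g} -> {within `[0, 1], continuous g'} ->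
  \forall d \near 0^'+, forall x y, third i x -> third i' y -> `|g x - g' y| < d ->
    exists x' y', [/\ third i x', third i' y' & g x' = g' y'].
Proof.
move=> gC gC'.
have [[x' [y' meet]]|apart] := pselect (exists x' y', [/\ third i x', third i' y' & g x' = g' y']).
  by near=> d => x y _ _ _; exists x', y'.
have cpt (f : R -> R * R) j : {within `[0, 1], continuous f} -> compact (f @` third j).
  move=> fC; apply: continuous_compact; last exact: segment_compact.
  by apply: continuous_subspaceW fC => x; exact: third_segment.
have := compact_dist_gt0 (cpt _ i gC) (cpt _ i' gC').
have -> : g @` third i `&` g' @` third i' = set0.
  apply/seteqP; split=> // _ [[x ix <-] [y iy eq_g]].
  by apply: apart; exists x, y.
move=> /(_ erefl); apply: filterS => d sep x y ix iy.
by rewrite ltNge sep.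
Unshelve. all: by end_near. Qed.

Variables (V E : finType) (s t : E -> V) (p : V -> R * R) (g : E -> R -> R * R).
Hypothesis g_cont : forall e, {within `[0, 1], continuous (g e)}.
Hypothesis g_src : forall e, g e 0 = p (s e).
Hypothesis g_tgt : forall e, g e 1 = p (t e).
Hypothesis st_neq : forall e, s e != t e.
Hypothesis simple : forall e e', [set s e; t e]%SET = [set s e'; t e']%SET -> e = e'.
Let is_end e (x : R) w := (x = 0 /\ s e = w) \/ (x = 1 /\ t e = w).
Hypothesis g_meet : forall e e' x y, `[0, 1] x -> `[0, 1] y -> e != e' ->
  g e x = g e' y -> exists2 w, is_end e x w & is_end e' y w.
Hypothesis g_inj : forall e, {in `[0, 1] &, injective (g e)}.

(** The curves are sampled so finely that consecutive samples are closer than the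
    mesh [h], hence fall into equal or neighbouring lattice columns and rows.
    One more lattice point, with the column of one sample and the row of the
    next, links them by horizontal and vertical steps.  The row of
    a lattice point is thus that of a number within [h] of the second coordinate
    of its sample, so that samples visiting the same lattice point are closer
    than [d = 3 h]; then the thirds that contain them meet. *)
Lemma curves_planar_dual : exists (F : finType) (l r : E -> F), planar_dual s t l r.
Proof.
pose sep d (j : E * E * ('I_3 * 'I_3)) := forall x y, third j.2.1 x -> third j.2.2 y ->
  `|g j.1.1 x - g j.1.2 y| < d ->
  exists x' y', [/\ third j.2.1 x', third j.2.2 y' & g j.1.1 x' = g j.1.2 y'].
have near_sep : \forall d \near 0^'+, forall j, sep d j.
  by apply: filter_forall => j; apply: separated_thirds; apply: g_cont.
near (0:R)^'+ => d.
have d0 : 0 < d by [].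
have dsep : forall j, sep d j by near: d.
pose h := d / 3.
have h0 : 0 < h by rewrite divr_gt0.
have dE : d = h * 3 by rewrite /h divfK.
have near_unif : \forall u \near 0^'+, forall e x y,
    `[0, 1] x -> `[0, 1] y -> `|x - y| < u -> `|g e x - g e y| < h.
  by apply: filter_forall => e; apply: uniform_steps.
near (0:R)^'+ => u.
have u0 : 0 < u by [].
have unif : forall e x y, `[0, 1] x -> `[0, 1] y -> `|x - y| < u -> `|g e x - g e y| < h.
  by near: u.
pose m := (Num.truncn u^-1).+1.
have mu : u^-1 < m%:R.
  have ui0 : 0 <= u^-1 by rewrite invr_ge0 ltW.
  by have /andP[] := truncn_itv ui0.
pose M := (3 * m)%N.
have half_le k : (k <= 2 * M)%N -> (k./2 <= M)%N by clear; lia.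
have half_lt k : (k < 2 * M)%N -> (k./2 < M)%N by clear; lia.
have odd_half_lt k : odd k -> (k <= 2 * M)%N -> (k./2 < M)%N by clear; lia.
have odd2M : odd (2 * M) = false by clear; lia.
have half2M : (2 * M)./2 = M by clear; lia.
have late_third k : (4 * m <= k <= 2 * M)%N -> (2 * m <= k./2 <= 3 * m)%N by clear; lia.
have half_odd k : odd k -> (k.+1)./2 = k./2.+1 by clear; lia.
have half_even k : ~~ odd k -> (k.+1)./2 = k./2 by clear; lia.
have M0 : 0 < M%:R :> R by rewrite ltr0n.
pose time i : R := i%:R / M%:R.
have time01 i : (i <= M)%N -> `[0, 1] (time i).
  by move=> iM; rewrite /= in_itv /= divr_ge0 // ler_pdivrMr // mul1r ler_nat.
have step e i : (i < M)%N -> `|g e (time i) - g e (time i.+1)| < h.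
  move=> iM; apply: unif; [exact/time01/ltnW | exact: time01 |].
  rewrite /time -mulrBl -natr1 opprD addrA subrr sub0r mulN1r normrN gtr0_norm ?invr_gt0 //.
  rewrite invf_plt ?posrE // (lt_le_trans mu) // ler_nat; lia.
have near_C : \forall C \near +oo, forall j : E * 'I_M.+1, `|g j.1 (time j.2)| <= C.
  by apply: filter_forall => j; exact: nbhs_pinfty_ge.
(* Translating by [C] makes all coordinates nonnegative, as truncation requires. *)
near +oo_R => C.
have gC e i : (i <= M)%N -> `|g e (time i)| <= C.
  move=> iM; have gCj : forall j : E * 'I_M.+1, `|g j.1 (time j.2)| <= C by near: C.
  by have := gCj (e, inord i); rewrite /= inordK.
pose cell (q : R * R) : nat * nat :=
  (Num.truncn ((q.1 + C) / h), Num.truncn ((q.2 + C) / h)).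
pose q e i := g e (time i).
have qC e i : (i <= M)%N -> (0 <= (q e i).1 + C <= C + C) && (0 <= (q e i).2 + C <= C + C).
  move=> /(gC e); rewrite prod_normE ge_max !ler_norml -/(q e i) => /andP[/andP[? ?] /andP[? ?]].
  lra.
have addCK x y : (x + C) - (y + C) = x - y.
  by rewrite opprD addrACA subrr addr0.
pose walk e k : nat * nat :=
  if odd k then ((cell (q e k./2)).1, (cell (q e k./2.+1)).2) else cell (q e k./2).
have coords (x y : R * R) : `|x - y| < h -> `|x.1 - y.1| < h /\ `|x.2 - y.2| < h.
  by rewrite prod_normE gt_max => /andP.
have walk_spec e k : (k <= 2 * M)%N -> exists y : R,
    [/\ 0 <= y + C <= C + C, `|(q e k./2).2 - y| < h &
       walk e k = (Num.truncn (((q e k./2).1 + C) / h), Num.truncn ((y + C) / h))].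
  move=> kM; rewrite /walk; case: ifP => [ok|_].
    have kM2 : (k./2.+1 <= M)%N by exact: odd_half_lt.
    exists (q e k./2.+1).2; split=> //; first by case/andP: (qC e _ kM2).
    by have [] := coords _ _ (step e k./2 kM2).
  exists (q e k./2).2; split=> //; last by rewrite subrr normr0.
  by have /andP[] := qC e _ (half_le _ kM).
pose N := Num.truncn ((C + C) / h).
have truncN x : 0 <= x + C <= C + C -> (Num.truncn ((x + C) / h) <= N)%N.
  by move=> /andP[_ xC]; apply: le_truncn; rewrite ler_pM2r // invr_gt0.
have walkN e k : (k <= 2 * M)%N -> ((walk e k).1 <= N)%N /\ ((walk e k).2 <= N)%N.
  move=> kM; have [y [yC _ ->]] := walk_spec e k kM; split; apply: truncN => //.
  by have /andP[] := qC e _ (half_le _ kM).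
have walk_close e e' k k' : (k <= 2 * M)%N -> (k' <= 2 * M)%N ->
    torus_point N (walk e k) = torus_point N (walk e' k') ->
    `|q e k./2 - q e' k'./2| < d.
  move=> kM kM' /torus_point_inj eq_walk.
  have [[b1 b2] [b3 b4]] := (walkN e k kM, walkN e' k' kM').
  move: (eq_walk b1 b2 b3 b4).
  have [y [/andP[y0 _] yh ->]] := walk_spec e k kM.
  have [y' [/andP[y0' _] yh' ->]] := walk_spec e' k' kM'.
  have /andP[/andP[x0 _] _] := qC e _ (half_le _ kM).
  have /andP[/andP[x0' _] _] := qC e' _ (half_le _ kM').
  case=> /(truncn_eq_dist h0 x0 x0') + /(truncn_eq_dist h0 y0 y0').
  rewrite !addCK => xx' yy'.
  rewrite prod_normE gt_max dE; apply/andP; split.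
    by apply: lt_trans xx' _; rewrite ltr_pMr // ltr1n.
  exact: dist3 yh yh' yy'.
have walk_steps e : steps (@tsrc N) (@ttgt N) (@off_seam N)
    (fun k => torus_point N (walk e k)) (2 * M).
  move=> k kM.
  have iM := half_lt _ kM.
  have [n1 n2] := coords _ _ (step e k./2 iM).
  have /andP[qk1 qk2] := qC e _ (ltnW iM); have /andP[qk1' qk2'] := qC e _ iM.
  have close (x y : R) : 0 <= x + C <= C + C -> 0 <= y + C <= C + C -> `|x - y| < h ->
      (Num.truncn ((x + C) / h) <= (Num.truncn ((y + C) / h)).+1)%N.
    move=> /andP[x0 _] /andP[y0 _] xy; apply: truncn_close => //.
    by rewrite addCK.
  rewrite /walk /= uphalfE; have [ok|ek] := boolP (odd k).
    by rewrite half_odd //; apply: torus_hstep; rewrite ?truncN // close // distrC.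
  by rewrite half_even //; apply: torus_vstep; rewrite ?truncN // close // distrC.
have in_third k : (k <= 2 * M)%N -> exists2 i : 'I_3, third i (time k./2) &
    forall e x w, third i x -> is_end e x w -> near_end s t (2 * m) (4 * m) e k w.
  move=> kM; have m0 : (0 < m)%N by [].
  have ends (i : 'I_3) : (i = 0 :> nat -> (k < 2 * m)%N) -> (i = 2 :> nat -> (4 * m <= k)%N) ->
      forall e x w, third i x -> is_end e x w -> near_end s t (2 * m) (4 * m) e k w.
    move=> i0 i2 e x w ix [[x0 <-]|[x1 <-]]; rewrite /near_end eqxx.
      by rewrite x0 in ix; rewrite i0 //; exact: third0.
    by rewrite x1 in ix; rewrite i2 ?orbT //; exact: third1.
  have [i [ik i0 i2]] : exists i : 'I_3, [/\ (i * m <= k./2 <= i.+1 * m)%N,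
      i = 0 :> nat -> (k < 2 * m)%N & i = 2 :> nat -> (4 * m <= k)%N].
    exact: third_index.
  exists i; [exact: third_ratio | exact: ends].
have F0 : (2 * m <= 4 * m <= 2 * M)%N by rewrite /M; lia.
have [||||l [r dual]] := drawing_planar_dual (@torus_cobd_cycle N) (@torus_cycle_cobd N)
  F0 st_neq simple (b := fun v => torus_point N (cell (p v)))
  (g := fun e k => torus_point N (walk e k)) _ _ walk_steps.
- by move=> e; rewrite /walk /= /q /time mul0r g_src.
- by move=> e; rewrite /walk odd2M half2M /q /time divff ?g_tgt // gt_eqF.
- move=> e k akM; have /andP[_ kM] := akM; apply/eqP => /(walk_close e e 0 k isT kM) close.
  have first : third (@Ordinal 3 0 isT) (time 0) by apply: third_ratio; rewrite ?mul0n.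
  have last : third (@Ordinal 3 2 isT) (time k./2) by apply: third_ratio => //; exact: late_third.
  have [x [y [x1 y2]]] := dsep (e, e, (_, _)) _ _ first last close.
  have x01 := third_segment x1; have y01 := third_segment y2.
  move=> /(g_inj (mem_set x01) (mem_set y01)) xy; move: x1 y2; rewrite xy /third /= !in_itv /=; lra.
- move=> e e' k k' kM kM' ne /(walk_close e e' k k' kM kM') close.
  have [i ki iend] := in_third k kM; have [i' ki' iend'] := in_third k' kM'.
  have [x [y [xi yi]]] := dsep (e, e', (i, i')) _ _ ki ki' close.
  have x01 := third_segment xi; have y01 := third_segment yi.
  move=> /(g_meet x01 y01 ne)[w ex ey]; exists w; [exact: iend ex | exact: iend' ey].
- by do 3!eexists; exact: dual.
Unshelve. all: by end_near. Qed.

End Curves.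

(** * Planar triangle-free graphs *)

Section UpperBound.
Variables (T : finType) (G : sgraph T).

Lemma card_edge e : e \in edges G -> #|e| = 2.
Proof. by move=> eG; have /forall_inP/(_ e eG)/eqP := edges_card2 G. Qed.

Lemma edge_at e v : e \in edges G -> v \in e -> exists2 w, w != v & e = [set v; w].
Proof.
move=> /card_edge/eqP/cards2P[x [y [xy ->]]]; rewrite !inE => /orP[]/eqP->.
  by exists y; rewrite // eq_sym.
by exists x; rewrite // finset.setUC.
Qed.

Lemma edge_neq x y : [set x; y] \in edges G -> x != y.
Proof. by move=> /card_edge; rewrite cards2; case: eqP. Qed.

Lemma triangle_subgraph x y z :
  [set x; y] \in edges G -> [set y; z] \in edges G -> [set z; x] \in edges G ->
  has_subgraph (cycle_graph 3) G.
Proof.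
move=> xy yz zx; pose f (i : 'I_3) := tnth [tuple x; y; z] i.
have f_inj : injective f.
  apply/tuple_uniqP; rewrite /= !inE !negb_or (edge_neq xy) (edge_neq yz).
  by rewrite eq_sym (edge_neq zx).
exists f; split=> // e; rewrite inE => /andP[_ /existsP[u /existsP[v /andP[/eqP-> /eqP->]]]].
rewrite imsetU1 imset_set1; case: u => -[|[|[|//]]] u3.
- by rewrite /f !(tnth_nth x).
- by rewrite /f !(tnth_nth x).
- by rewrite /f !(tnth_nth x).
Qed.

(** Every end of an edge of [z] lies on another edge of [z].  Start from an edge
    [e1] = uv and continue by [e2] = vw and [e3] at w on one side, and by [e4] at
    u on the other; [e3] and [e4] could only coincide by closing a triangle. *)
Lemma cycle_length (s t : {e | e \in edges G} -> T) (z : {set {e | e \in edges G}}) :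
  ~ has_subgraph (cycle_graph 3) G ->
  (forall e, val e = [set s e; t e]) -> z != finset.set0 ->
  (forall v, bd s t (mem z) v = false) -> 4 <= #|z|.
Proof.
move=> no3 stE /finset.set0Pn[e1 e1z] cyc.
have st_neq e : s e != t e by apply: edge_neq; rewrite -stE; exact: valP.
have other e v : e \in z -> v \in val e -> exists e', [/\ e' \in z, e' != e & v \in val e'].
  move=> ez ve; have incE e' : ((s e' == v) (+) (t e' == v)) = (v \in val e').
    rewrite stE !inE ![v == _]eq_sym.
    have : ~~ ((s e' == v) && (t e' == v)).
      by apply: contra (st_neq e') => /andP[/eqP-> /eqP->].
    by do 2!case: (_ == v).
  case: (pickP (fun e' => [&& e' \in z, e' != e & v \in val e'])) => [e' /and3P[]|none].
    by exists e'.
  have := cyc v; rewrite /bd (bigD1 e) //= ez incE ve big1 // => e' ne.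
  by rewrite incE; have := none e'; rewrite ne.
have [u [v [uv e1E]]] : exists u v, u != v /\ val e1 = [set u; v].
  by exists (s e1), (t e1).
have [e2 [e2z e21 ve2]] : exists e', [/\ e' \in z, e' != e1 & v \in val e'].
  by apply: other; rewrite // e1E !inE eqxx orbT.
have [w wv e2E] := edge_at (valP e2) ve2.
have [e3 [e3z e32 we3]] : exists e', [/\ e' \in z, e' != e2 & w \in val e'].
  by apply: other; rewrite // e2E !inE eqxx orbT.
have [e4 [e4z e41 ue4]] : exists e', [/\ e' \in z, e' != e1 & u \in val e'].
  by apply: other; rewrite // e1E !inE eqxx.
have wu : w != u.
  by apply: contra_neq e21 => wu; apply: val_inj; rewrite e1E e2E wu finset.setUC.
have e31 : e3 != e1.
  by apply: contraTneq we3 => ->; rewrite e1E !inE (negbTE wu) (negbTE wv).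
have e42 : e4 != e2.
  by apply: contraTneq ue4 => ->; rewrite e2E !inE eq_sym [u == w]eq_sym (negbTE wu) eq_sym
      (negbTE uv).
have e43 : e4 != e3.
  apply/eqP => e43; rewrite e43 in ue4.
  have [x xw e3E] := edge_at (valP e3) we3.
  move: ue4; rewrite e3E !inE eq_sym (negbTE wu) /= => /eqP ux.
  apply: no3; apply: (@triangle_subgraph u v w).
  - by rewrite -e1E; exact: valP.
  - by rewrite -e2E; exact: valP.
  - by rewrite ux -e3E; exact: valP.
have uniq4 : uniq [:: e1; e2; e3; e4].
  rewrite /= !inE !negb_or [e1 == e2]eq_sym e21 [e1 == e3]eq_sym e31 [e1 == e4]eq_sym e41.
  by rewrite [e2 == e3]eq_sym e32 [e2 == e4]eq_sym e42 [e3 == e4]eq_sym e43.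
rewrite cardE; apply: (uniq_leq_size uniq4) => e; rewrite mem_enum !inE.
by case/or4P => /eqP ->.
Qed.

Lemma planar_triangle_free_bound (R : realType) :
  planar R G -> ~ has_subgraph (cycle_graph 3) G -> 3 <= #|T| ->
  #|edges G| + 4 <= 2 * #|T|.
Proof.
move=> [p [A [p_inj arcs vertex_on meet]]] no3 T3.
have ends (e : {e | e \in edges G}) : exists st : T * T, val e = [set st.1; st.2].
  by have /card_edge/eqP/cards2P[x [y [_ ->]]] := valP e; exists (x, y).
have [st stE] := fin_all_exists ends.
pose s e := (st e).1; pose t e := (st e).2.
have eG e : [set s e; t e] \in edges G by rewrite -stE; exact: valP.
have [g gP] := fin_all_exists (fun e => arcs _ _ (eG e)).
have [F [l [r dual]]] : exists (F : finType) (l r : {e | e \in edges G} -> F), planar_dual s t l r.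
  apply: (@curves_planar_dual R _ _ s t p g).
  - by move=> e; have [] := gP e.
  - by move=> e; have [] := gP e.
  - by move=> e; have [] := gP e.
  - by move=> e; exact: edge_neq (eG e).
  - by move=> e e'; rewrite -!stE => /val_inj.
  - pose I01 : set R := `[0%R, 1%R]%classic.
    move=> e e' x y x01 y01 ne gxy.
    have [_ gi g0 g1 gA] := gP e; have [_ gi' g0' g1' gA'] := gP e'.
    have zero : I01 0%R by rewrite /I01 /= in_itv /= lexx ler01.
    have one : I01 1%R by rewrite /I01 /= in_itv /= lexx ler01.
    have [|||w] := meet (val e) (val e') (g e x) (valP e) (valP e').
    + by apply: contra ne => /eqP/val_inj->.
    + by rewrite stE gA; exists x.
    + by rewrite stE gA' gxy; exists y.
    rewrite !inE !stE !inE => /andP[we we'] gw.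
    have endE f z : (forall x y, I01 x -> I01 y -> g f x = g f y -> x = y) ->
        g f 0%R = p (s f) -> g f 1%R = p (t f) -> I01 z ->
        (w == s f) || (w == t f) -> g f z = p w ->
        z = 0%R /\ s f = w \/ z = 1%R /\ t f = w.
      move=> finj f0 f1 z01 /orP[]/eqP-> fz; [left|right]; split=> //; apply: finj => //.
        by rewrite f0.
      by rewrite f1.
    exists w; [apply: endE | apply: endE] => //.
    + by move=> a b /mem_set a01 /mem_set b01; exact: gi.
    + by move=> a b /mem_set a01 /mem_set b01; exact: gi'.
    + by rewrite -gxy.
  - by move=> e; have [] := gP e.
have := planar_dual_edge_bound dual _ T3; rewrite card_sig; apply=> z.
exact: cycle_length.
Qed.

End UpperBound.

(** * The complete bipartite graph K_(2,m) *)

Section CompleteBipartite.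
Variable m : nat.
Notation K := (complete_bipartite 2 m).
Notation vtx := ('I_2 + 'I_m)%type.

Definition bip_edge (ij : 'I_2 * 'I_m) : {set vtx} := [set inl ij.1; inr ij.2].

Lemma bip_edge_inj : injective bip_edge.
Proof.
move=> [i j] [i' j'] /= eqe.
have : inl i \in bip_edge (i', j') by rewrite -eqe !inE eqxx.
have : inr j \in bip_edge (i', j') by rewrite -eqe !inE eqxx orbT.
by rewrite !inE /= orbF => /eqP[->] /eqP[->].
Qed.

Lemma bip_edgesP (e : {set vtx}) : reflect (exists ij, e = bip_edge ij) (e \in edges K).
Proof.
apply: (iffP idP) => [|[[i j] ->]].
  rewrite inE => /andP[_ /existsP[[i|i] /existsP[[j|j] /andP[//= _ /eqP->]]]].
  by exists (i, j).
rewrite inE cards2 /=; apply/existsP; exists (inl i); apply/existsP; exists (inr j).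
by rewrite /= eqxx.
Qed.

Lemma card_bip_edges : #|edges K| = 2 * m.
Proof.
have -> : edges K = [set bip_edge ij | ij in [set: 'I_2 * 'I_m]]%SET.
  apply/finset.setP => e; apply/bip_edgesP/imsetP => [[ij ->]|[ij _ ->]]; by exists ij.
by rewrite card_imset ?cardsT ?card_prod ?card_ord //; exact: bip_edge_inj.
Qed.

Lemma bip_edge_sides (u v : vtx) : [set u; v] \in edges K ->
  exists i j, (u = inl i /\ v = inr j) \/ (u = inr j /\ v = inl i).
Proof.
move=> /bip_edgesP[[i j] eqe].
have : u \in bip_edge (i, j) by rewrite -eqe !inE eqxx.
have : v \in bip_edge (i, j) by rewrite -eqe !inE eqxx orbT.
have : inl i \in [set u; v] by rewrite eqe !inE eqxx.
have : inr j \in [set u; v] by rewrite eqe !inE eqxx orbT.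
rewrite !inE; case: u v {eqe} => [i'|i'] [j'|j'] //=; rewrite ?orbF ?orFb.
- by move=> _ _ /eqP[->] /eqP[->]; exists i, j; left.
- by move=> _ _ /eqP[->] /eqP[->]; exists i, j; right.
Qed.

(** The vertices 0, 2 and 4 steps along the cycle from one on the side of size two
    are all on that side, so two of the three coincide. *)
Lemma bip_cycle_free k : 1 < k -> ~~ (k %| 2) -> ~~ (k %| 4) ->
  ~ has_subgraph (cycle_graph k) K.
Proof.
move=> k1 k2 k4 [f [f_inj f_edges]].
have k0 : 0 < k by lia.
pose phi i := f (Ordinal (ltn_pmod i k0)).
have phi_edge i : [set phi i; phi i.+1] \in edges K.
  have := f_edges [set Ordinal (ltn_pmod i k0); Ordinal (ltn_pmod i.+1 k0)].
  rewrite imsetU1 imset_set1; apply; rewrite inE.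
  have next : Ordinal (ltn_pmod i.+1 k0) = ordS (Ordinal (ltn_pmod i k0)).
    by apply: val_inj; rewrite /= -addn1 -[in RHS]addn1 modnDml.
  apply/andP; split; last first.
    apply/existsP; exists (Ordinal (ltn_pmod i k0)).
    by apply/existsP; exists (ordS (Ordinal (ltn_pmod i k0))); rewrite next !eqxx.
  rewrite cards2 -(inj_eq val_inj) /=.
  case: (eqVneq (i %% k) (i.+1 %% k)) => //= eqm.
  have : i + 0 == i + 1 %[mod k] by rewrite addn0 addn1 eqm.
  by rewrite eqn_modDl mod0n modn_small.
have phi_eq i d : phi i = phi (i + d) -> k %| d.
  move=> /f_inj/(congr1 val)/= eqm.
  have : i + 0 == i + d %[mod k] by rewrite addn0 eqm.
  by rewrite eqn_modDl mod0n eq_sym.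
pose left (v : vtx) := if v is inl _ then true else false.
have alt i : left (phi i.+1) = ~~ left (phi i).
  by have [i' [j' [[-> ->]|[-> ->]]]] := bip_edge_sides (phi_edge i).
have [i0 lefti0] : exists i, left (phi i).
  by have := alt 0; case E: (left (phi 0)) => H; [exists 0 | exists 1; rewrite H].
have left2 i : left (phi i) -> left (phi (i + 2)) by move=> li; rewrite addn2 !alt negbK.
have := left2 _ (left2 _ lefti0); have := left2 _ lefti0; move: lefti0.
have e2 := @phi_eq i0 2; have e2' := @phi_eq (i0 + 2) 2; have e4 := @phi_eq i0 4.
rewrite -addnA /= in e2' *.
case E1: (phi i0) => [x|//] _; case E2: (phi (i0 + 2)) => [y|//] _.
case E3: (phi (i0 + (2 + 2))) => [w|//] _.
have x_y : x != y by apply/eqP => xy; case/negP: k2; apply: e2; rewrite E1 E2 xy.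
have y_w : y != w by apply/eqP => xy; case/negP: k2; apply: e2'; rewrite E2 E3 xy.
have x_w : x != w by apply/eqP => xy; case/negP: k4; apply: e4; rewrite E1 E3 xy.
have : uniq [:: x; y; w] by rewrite /= !inE negb_or x_y x_w y_w.
by move/card_uniqP => /= c3; have := max_card (mem [:: x; y; w]); rewrite c3 card_ord.
Qed.

End CompleteBipartite.

(** * Transport along a bijection of vertices *)

Section Transport.
Variables (T T' : finType) (f : T -> T') (f' : T' -> T).
Hypotheses (fK : cancel f f') (f'K : cancel f' f).
Variable G : sgraph T.

Definition image_edges := [set (f @: (e : {set T}))%SET | e in edges G]%SET.

Lemma image_edges_card2 : [forall e in image_edges, #|e| == 2].
Proof.
apply/forall_inP => _ /imsetP[e eG ->].
by rewrite card_imset ?(card_edge eG) //; exact: can_inj fK.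
Qed.

Definition image_graph : sgraph T' := SGraph image_edges_card2.

Lemma image_edgesE e : (e \in edges image_graph) = ((f' @: e)%SET \in edges G).
Proof.
apply/imsetP/idP => [[e' e'G ->]|eG].
  by rewrite -imset_comp (eq_imset (g := id)) ?imset_id // => x; exact: fK.
by exists (f' @: e)%SET; rewrite // -imset_comp (eq_imset (g := id)) ?imset_id // => x; exact: f'K.
Qed.

Lemma card_image_edges : #|edges image_graph| = #|edges G|.
Proof. by rewrite card_imset //; apply: imset_inj; exact: can_inj fK. Qed.

Lemma image_family_free (H : graph_family) : family_free H G -> family_free H image_graph.
Proof.
move=> free H0 HH0 [h [h_inj h_edges]]; apply: (free H0 HH0).
exists (f' \o h); split; first by apply: inj_comp h_inj; exact: can_inj f'K.
by move=> e /h_edges; rewrite image_edgesE -imset_comp.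
Qed.

Lemma image_planar (R : realType) : planar R G -> planar R image_graph.
Proof.
have f'_inj := can_inj f'K.
move=> [p [A [p_inj arcs vertex_on meet]]].
exists (p \o f'), (fun e : {set T'} => A (f' @: e)%SET); split.
- exact: inj_comp p_inj f'_inj.
- by move=> u v; rewrite image_edgesE imsetU1 imset_set1 => /arcs.
- by move=> e w; rewrite image_edgesE => eG /(vertex_on _ _ eG); rewrite mem_imset.
- move=> e e' x; rewrite !image_edgesE => eG eG' ne Ax Ax'.
  have [|w] := meet _ _ x eG eG' _ Ax Ax'.
    by apply: contra ne => /eqP/(imset_inj f'_inj)->.
  rewrite inE => /andP[/imsetP[w1 w1e ->] /imsetP[w2 w2e /f'_inj eqw]] ->.
  by exists w1; rewrite // inE w1e eqw w2e.
Qed.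

End Transport.

(** * A straight-line drawing of K_(2,m) *)

Section BipartiteDrawing.
Local Open Scope ring_scope.
Variables (R : realType) (m : nat).
Notation K := (complete_bipartite 2 m).
Notation vtx := ('I_2 + 'I_m)%type.

Definition pole (i : 'I_2) : R := if val i is 0%N then 1 else -1.

Definition bip_place (v : vtx) : R * R :=
  match v with inl i => (0, pole i) | inr j => (j.+1%:R, 0) end.

Definition bip_segment (ij : 'I_2 * 'I_m) (x : R) : R * R :=
  (ij.2.+1%:R * x, pole ij.1 * (1 - x)).

Definition bip_arc (e : {set vtx}) : set (R * R) :=
  [set q | exists ij, e = bip_edge ij /\ (bip_segment ij @` `[0, 1]) q]%classic.

Lemma pole_inj : injective pole.
Proof.
move=> [[|[|//]] i2] [[|[|//]] j2]; rewrite /pole /= => eq_pole; apply: val_inj => //=.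
  by exfalso; lra.
by exfalso; lra.
Qed.

Lemma pole_neq0 i : pole i != 0.
Proof. by case: i => [[|[|//]] i2]; rewrite /pole /= ?oppr_eq0 oner_eq0. Qed.

Lemma bip_place_inj : injective bip_place.
Proof.
move=> [i|j] [i'|j'] //=.
- by case=> /pole_inj ->.
- by case=> /esym/eqP; rewrite pnatr_eq0.
- by case=> /eqP; rewrite pnatr_eq0.
- by case=> /eqP; rewrite eqr_nat eqSS => /eqP/val_inj ->.
Qed.

Lemma bip_segment_inj ij : injective (bip_segment ij).
Proof. by move=> x y [/(mulfI (_ : _ != 0))-> //]; rewrite pnatr_eq0. Qed.

Lemma bip_segment_cont ij : continuous (bip_segment ij).
Proof.
move=> x.
have along : (ij.2.+1%:R * y @[y --> x] --> ij.2.+1%:R * x)%classic.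
  by apply: cvgM; [exact: cvg_cst | exact: cvg_id].
have down : (pole ij.1 * (1 - y) @[y --> x] --> pole ij.1 * (1 - x))%classic.
  by apply: cvgM; [exact: cvg_cst | apply: cvgB; [exact: cvg_cst | exact: cvg_id]].
exact: (cvg_pair along down).
Qed.

Lemma bip_arc_edge ij : bip_arc (bip_edge ij) = (bip_segment ij @` `[0, 1])%classic.
Proof.
apply/seteqP; split=> [q [ij' [/bip_edge_inj <- //]]|q qs]; by exists ij.
Qed.

Lemma bip_arc_down i j :
  is_arc (bip_arc (bip_edge (i, j))) (bip_place (inl i)) (bip_place (inr j)).
Proof.
exists (bip_segment (i, j)); split.
- by apply: continuous_subspaceT; exact: bip_segment_cont.
- by move=> x y _ _; exact: bip_segment_inj.
- by rewrite /bip_segment /= mulr0 subr0 mulr1.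
- by rewrite /bip_segment /= mulr1 subrr mulr0.
- exact: bip_arc_edge.
Qed.

Lemma bip_arc_up i j :
  is_arc (bip_arc (bip_edge (i, j))) (bip_place (inr j)) (bip_place (inl i)).
Proof.
exists (bip_segment (i, j) \o (fun x => 1 - x)); split.
- apply: continuous_subspaceT => x; apply: continuous_comp; last exact: bip_segment_cont.
  by apply: cvgB; [exact: cvg_cst | exact: cvg_id].
- by move=> x y _ _ /bip_segment_inj/addrI/oppr_inj.
- by rewrite /bip_segment /= subr0 mulr1 subrr mulr0.
- by rewrite /bip_segment /= subrr mulr0 subr0 mulr1.
- rewrite bip_arc_edge; apply/seteqP; split=> _ [x x01 <-];
    exists (1 - x); rewrite /= ?subKr //; move: x01; rewrite /= !in_itv /=; lra.
Qed.

Lemma planar_complete_bipartite2 : planar R K.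
Proof.
exists bip_place, bip_arc; split; first exact: bip_place_inj.
- move=> u v /[dup] /bip_edgesP[ij uvE] /bip_edge_sides uv.
  case: uv uvE => i [j [[-> ->]|[-> ->]]] _; first exact: bip_arc_down.
  rewrite finset.setUC; exact: bip_arc_up.
- move=> e w /bip_edgesP[[i j] ->]; rewrite bip_arc_edge => -[x x01].
  case: w => [i'|j'] /= [] /eqP.
    rewrite mulf_eq0 pnatr_eq0 /= => /eqP-> ; rewrite subr0 mulr1 => /pole_inj->.
    by rewrite !inE eqxx.
  move=> /eqP xE /eqP; rewrite mulf_eq0 (negbTE (pole_neq0 i)) subr_eq0 /= => /eqP x1.
  move: xE; rewrite -x1 mulr1 => /eqP; rewrite eqr_nat eqSS => /eqP/val_inj->.
  by rewrite !inE eqxx orbT.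
- move=> e e' q /bip_edgesP[[i j] ->] /bip_edgesP[[i' j'] ->] ne.
  rewrite !bip_arc_edge => -[x + <-] [y + [/= xy1 xy2]].
  rewrite /= !in_itv /= => /andP[x0 x1] /andP[y0 y1].
  have [ii|ii] := eqVneq i i'.
    subst i'.
    have xy : y = x by move/(mulfI (pole_neq0 i)): xy2; lra.
    subst y; have [x00|xn0] := eqVneq x 0.
      exists (inl i); first by rewrite !inE !eqxx.
      by rewrite /bip_segment x00 /= mulr0 subr0 mulr1.
    case/eqP: ne; congr (bip_edge (_, _)); apply: val_inj; apply/eqP.
    by move/(mulIf xn0)/eqP: xy1; rewrite eqr_nat eqSS eq_sym.
  have [x11 y11] : x = 1 /\ y = 1.
    move: ii xy2; rewrite /pole; case: i {ne} => [[|[|//]] ?]; case: i' => [[|[|//]] ?] /=;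
      by move=> // _ xy2; split; lra.
  have jj : j = j'.
    by move: xy1; rewrite x11 y11 !mulr1 => /eqP; rewrite eqr_nat eqSS => /eqP/val_inj.
  exists (inr j); first by rewrite -jj !inE !eqxx !orbT.
  by rewrite /bip_segment x11 /= mulr1 subrr mulr0.
Qed.

End BipartiteDrawing.

(** * The planar Turan number *)

Theorem theorem1p3 (R : realType) (n k : nat) (hn : 4 <= n) (hk : 5 <= k) :
  planar_turan R n (family2 (cycle_graph 3) (cycle_graph k)) = 2 * n - 4 /\
  [/\ #|vertex (complete_bipartite 2 (n - 2))| = n,
      planar R (complete_bipartite 2 (n - 2)),
      family_free (family2 (cycle_graph 3) (cycle_graph k))
        (complete_bipartite 2 (n - 2))
    & #|edges (complete_bipartite 2 (n - 2))| = 2 * n - 4].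
Proof.
set K := complete_bipartite 2 (n - 2).
have cardV : #|vertex K| = n by rewrite card_sum !card_ord; lia.
have planarK : planar R K by exact: planar_complete_bipartite2.
have freeK : family_free (family2 (cycle_graph 3) (cycle_graph k)) K.
  by move=> H [->|->]; apply: bip_cycle_free => //; [lia | |]; apply/negP => /dvdn_leq; lia.
have cardK : #|edges K| = 2 * n - 4 by rewrite card_bip_edges; lia.
split=> //.
apply/eqP; rewrite eqn_leq; apply/andP; split.
  apply/bigmax_leqP => G /asboolP[planarG freeG].
  have no3 : ~ has_subgraph (cycle_graph 3) G by apply: freeG; left.
  have := planar_triangle_free_bound planarG no3; rewrite card_ord; lia.
pose f : vertex K -> 'I_n := cast_ord cardV \o enum_rank.
pose f' : 'I_n -> vertex K := enum_val \o cast_ord (esym cardV).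
have fK : cancel f f' by move=> v; rewrite /f /f' /= cast_ordK enum_rankK.
have f'K : cancel f' f by move=> i; rewrite /f /f' /= enum_valK cast_ordKV.
rewrite -cardK -(card_image_edges fK K).
apply: leq_bigmax_cond; apply/asboolP; split.
  exact: image_planar.
exact: image_family_free.
Qed.
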